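(* Let $m \geq 1$ be an integer. Let $G$ be an edge-colored complete graph on $n \geq 9m+8$ vertices. If $$c(G) > mn - \binom{m+1}{2},$$ then $G$ contains a proper $mK_3$.
   Context: All graphs are finite and simple. An edge-colored graph is a graph $G$ together with an arbitrary map $C:E(G)\to\mathbb{N}$ (not necessarily a proper coloring). $c(G)=|C(E(G))|$ is the number of distinct colors appearing on the edges of $G$. An edge-colored graph is rainbow if no two of its edges share the same color. A proper $mK_3$ is a union of $m$ pairwise vertex-disjoint rainbow triangles (each triangle is rainbow; different triangles may share colors). *)

(* Defs.v *)
From mathcomp Require Import all_boot.
Set Implicit Arguments.
Unset Strict Implicit.
Unset Printing Implicit Defensive.

(* An edge is the two-element set of its ends.  [col] is total on sets of
   vertices, but only its values on [edges] are ever used below. *)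
Record ecgraph (V : finType) := ECGraph {
  adj : rel V;
  adj_sym : symmetric adj;
  adj_irr : irreflexive adj;
  col : {set V} -> nat
}.

Section EdgeColoredGraphs.
Variables (V : finType) (G : ecgraph V).

Definition edges : {set {set V}} :=
  [set [set x; y] | x in V, y in V & adj G x y].

Definition complete : Prop := forall x y : V, x != y -> adj G x y.

Definition ncolors : nat := size (undup [seq col G e | e in edges]).

Definition rainbow (F : {set {set V}}) : Prop := {in F &, injective (col G)}.

Definition triangle (T : {set V}) : Prop :=
  #|T| = 3 /\ {in T &, forall x y : V, x != y -> adj G x y}.

Definition rainbow_triangle (T : {set V}) : Prop :=
  triangle T /\ rainbow [set e in edges | e \subset T].

(* Edges of different triangles may share colors. *)
Definition has_proper_mK3 (m : nat) : Prop :=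
  exists T : 'I_m -> {set V},
    (forall i : 'I_m, rainbow_triangle (T i)) /\
    (forall i j : 'I_m, i != j -> [disjoint T i & T j]).

End EdgeColoredGraphs.

(* Main.v *)
(** Write [c(A)] for the number of colours inside [A].  If two colours appear on
    edges from [a] to [D] but not inside [D], the ends of two such edges span with
    [a] a rainbow triangle; hence (Gallai) [c(A) >= |A|] forces a rainbow triangle.
    By induction on [m] there are [m - 1] disjoint rainbow triangles, with vertex
    set [T], and we may assume [c(A \ T) < |A \ T|].  So many colours are lost with
    [T], and a minimal set [B] losing more than a suitable number of colours has all its
    vertices send many new colours to [A \ B].  By induction [A \ B] contains [m - |B|]
    disjoint rainbow triangles, and each vertex of [B] is the apex of a further one
    based in [A \ B]. *)
Require Import Defs.
From mathcomp Require Import all_boot.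
From mathcomp Require Import zify.

Section Packing.
Variables (V C : finType) (c : {set V} -> C).
Implicit Types (A B D S T U : {set V}) (P : {set {set V}}).

(** In a complete graph the edges inside [A] are exactly its two-element subsets, so adjacency drops
    out of the argument. *)
Definition pairs A : {set {set V}} := [set e : {set V} | e \subset A & #|e| == 2].

Definition colors A : {set C} := c @: pairs A.

Definition rainbow_3set T : Prop := #|T| = 3 /\ {in pairs T &, injective c}.

Definition packing A m P : Prop :=
  [/\ #|P| = m, trivIset P, cover P \subset A
    & forall T, T \in P -> rainbow_3set T].

Definition new_colors (a : V) D : {set C} := colors (a |: D) :\: colors D.

Lemma pair_in_pairs A x y : x \in A -> y \in A -> x != y -> [set x; y] \in pairs A.
Proof. by move=> xA yA xy; rewrite inE subUset !sub1set xA yA cards2 xy. Qed.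

Lemma colorsS {A B} : A \subset B -> colors A \subset colors B.
Proof.
move=> AB; apply/imsetS/subsetP => e; rewrite !inE => /andP[eA ->].
by rewrite (subset_trans eA AB).
Qed.

Lemma card_colorsU1 a D : #|colors (a |: D)| = #|colors D| + #|new_colors a D|.
Proof.
have /colorsS/setIidPr sDa : D \subset a |: D by apply: subsetUr.
by rewrite -(cardsID (colors D) (colors (a |: D))) sDa.
Qed.

Lemma new_colorP {a D k} :
  k \in new_colors a D -> exists2 x, x \in D & k = c [set a; x].
Proof.
case/setDP => /imsetP[e]; rewrite inE => /andP[eaD /cards2P[x [y [xy De]]]] Dk kD.
move: eaD; rewrite De subUset !sub1set => /andP[/setU1P xaD /setU1P yaD].
case: xaD => [xa | xD]; case: yaD => [ya | yD].
- by rewrite xa ya eqxx in xy.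
- by exists y; rewrite // Dk De xa.
- by exists x; rewrite // Dk De ya setUC.
- by case/negP: kD; rewrite Dk De imset_f ?pair_in_pairs.
Qed.

Lemma card_new_colors a D : #|new_colors a D| <= #|D|.
Proof.
apply: leq_trans (leq_imset_card (fun x => c [set a; x]) _).
by apply/subset_leq_card/subsetP=> k /new_colorP[x xD ->]; apply: imset_f.
Qed.

Lemma pairs_3set x y z e : e \in pairs [set x; y; z] ->
  [|| e == [set x; y], e == [set x; z] | e == [set y; z]].
Proof.
rewrite inE => /andP[eT /cards2P[u [v [uv De]]]].
move: eT; rewrite {}De subUset !sub1set !inE -!orbA => /andP[uT vT].
move: uT vT uv => /or3P[] /eqP-> /or3P[] /eqP->; rewrite ?eqxx ?orbT //=.
- by rewrite setUC eqxx.
- by rewrite (setUC [set z]) eqxx orbT.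
- by rewrite (setUC [set z]) eqxx !orbT.
Qed.

Lemma rainbow_3setI x y z : x != y -> x != z -> y != z ->
  c [set x; y] != c [set x; z] -> c [set x; y] != c [set y; z] ->
  c [set x; z] != c [set y; z] -> rainbow_3set [set x; y; z].
Proof.
move=> xy xz yz c1 c2 c3; split.
  by rewrite setUC cardsU1 cards2 !inE xy negb_or eq_sym xz eq_sym yz.
move=> e f /pairs_3set + /pairs_3set.
by move=> /or3P[] /eqP-> /or3P[] /eqP-> // /eqP;
  rewrite ?(negPf c1) ?(negPf c2) ?(negPf c3) // eq_sym
    ?(negPf c1) ?(negPf c2) ?(negPf c3).
Qed.

(* Two new colours on [a x] and [a y] differ from the colour of [x y], which is old. *)
Lemma new_colors_triangle {a D} U : a \notin D -> #|U| + 2 <= #|new_colors a D| ->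
  exists x y, [/\ x \in D :\: U, y \in D :\: U & rainbow_3set [set a; x; y]].
Proof.
move=> aD hU; pose F := [set c [set a; u] | u in U].
(* [F] has at most [#|U|] colours, so two new colours lie outside it, and their ends in [D] avoid
   [U]. *)
have: 1 < #|new_colors a D :\: F|.
  have := cardsID F (new_colors a D); have := leq_imset_card (fun u => c [set a; u]) U.
  have := subset_leq_card (subsetIr (new_colors a D) F); rewrite -/F; lia.
case/card_gt1P=> k [l [/setDP[kN kF] /setDP[lN lF] kl]].
have [x xD Dk] := new_colorP kN; have [y yD Dl] := new_colorP lN.
have notU z : c [set a; z] \notin F -> z \notin U by apply/contra/imset_f.
have neqa z : z \in D -> a != z by apply: contraTneq => <-.
have xy : x != y by apply: contra_neq kl => xy; rewrite Dk Dl xy.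
have old : c [set x; y] \in colors D by rewrite imset_f ?pair_in_pairs.
exists x, y; split; first by rewrite inE xD notU // -Dk.
  by rewrite inE yD notU // -Dl.
apply: rainbow_3setI; rewrite ?neqa // -?Dk -?Dl //.
  by apply: contraTneq kN => ->; rewrite inE old.
by apply: contraTneq lN => ->; rewrite inE old.
Qed.

Lemma colors_card_le1 {A} : #|A| <= 1 -> colors A = set0.
Proof.
move=> A1; apply/setP=> k; rewrite inE; apply/imsetP=> -[e].
rewrite inE => /andP[/subset_leq_card eA /eqP e2] _.
by move: (leq_trans eA A1); rewrite e2.
Qed.

(* Without a rainbow triangle, deleting a vertex removes at most one colour. *)
Lemma rainbow_3set_exists A : 0 < #|A| -> #|A| <= #|colors A| ->
  exists2 T : {set V}, T \subset A & rainbow_3set T.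
Proof.
move Dn: #|A| => n; elim: n A Dn => // n IHn A Dn _ hA.
have [a aA] : exists a, a \in A by apply/card_gt0P; rewrite Dn.
have cD : #|A :\ a| = n by move: Dn; rewrite (cardsD1 a) aA => -[].
have aD : a \notin A :\ a by rewrite !inE eqxx.
have [h | h] := leqP 2 #|new_colors a (A :\ a)|.
  have [|x [y [xD yD rT]]] := new_colors_triangle set0 aD; first by rewrite cards0.
  exists [set a; x; y] => //; move: xD yD; rewrite !inE => /and3P[_ _ xA] /and3P[_ _ yA].
  by rewrite !subUset !sub1set aA xA yA.
(* The induction hypothesis needs a nonempty set; a single vertex spans no colour, against [hA]. *)
have [n0 | n0] := posnP n.
  by move: hA; rewrite colors_card_le1 ?Dn ?n0 ?cards0.
move: hA; rewrite -{1}(setD1K aA) card_colorsU1 => hA.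
have [||T TD rT] := IHn _ cD; [by []|lia|].
by exists T => //; apply: subset_trans TD (subD1set _ _).
Qed.

(** * Packings of disjoint rainbow triangles *)

Lemma card_cover_packing A m P : packing A m P -> #|cover P| = 3 * m.
Proof.
case=> <- tP _ rP; rewrite -(eqP tP) (eq_bigr (fun=> 3)); first by rewrite sum_nat_const mulnC.
by move=> T /rP[].
Qed.

Lemma packing0 A : packing A 0 set0.
Proof.
split; rewrite ?cards0 //; last by move=> T; rewrite inE.
  by apply/trivIsetP=> T U; rewrite inE.
by rewrite /cover big_set0 sub0set.
Qed.

Lemma packingS {A B m P} : A \subset B -> packing A m P -> packing B m P.
Proof. by move=> AB [mP tP PA rP]; split=> //; apply: subset_trans AB. Qed.

Lemma packingU1 {A m P T} : packing A m P -> rainbow_3set T -> T \subset A ->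
  [disjoint T & cover P] -> packing A m.+1 (T |: P).
Proof.
case=> <- tP sPA rP rT TA dT.
have [|//||tTP TP] := @trivIsetU1 V T P.
- by move=> U UP; apply: disjointWr dT; apply: bigcup_sup.
- by apply/negP=> P0; have [] := rP _ P0; rewrite cards0.
split=> //.
- by rewrite cardsU1 TP.
- by rewrite /cover big_setU1 // subUset TA.
- by move=> U /setU1P[-> | /rP].
Qed.

(* Each vertex of [S] in turn is the apex of a triangle with base in [D], so every
   step uses up only two vertices of [D]. *)
Lemma packing_extend A D S m K P :
  packing A m P -> D \subset A -> S \subset A -> [disjoint S & D] ->
  [disjoint S & cover P] -> (forall a, a \in S -> K <= #|new_colors a D|) ->
  #|cover P :&: D| + 2 * #|S| <= K -> exists P', packing A (m + #|S|) P'.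
Proof.
move Ds: #|S| => s; elim: s S Ds m P => [|s IHs] S Ds m P pP DA SA dSD dSP hK leK.
  by exists P; rewrite addn0.
have [a aS] : exists a, a \in S by apply/card_gt0P; rewrite Ds.
have aD : a \notin D by rewrite (disjointFr dSD).
have [|x [y [+ + rT]]] := new_colors_triangle (cover P :&: D) aD.
  by have := hK a aS; lia.
rewrite !inE => /andP[xP xD] /andP[yP yD].
rewrite xD andbT in xP; rewrite yD andbT in yP.
have dTP : [disjoint [set a; x; y] & cover P].
  rewrite disjoints_subset !subUset !sub1set !inE xP yP !andbT.
  by rewrite (disjointFr dSP aS).
have TA : [set a; x; y] \subset A.
  by rewrite !subUset !sub1set (subsetP SA) // !(subsetP DA).
have pP1 := packingU1 pP rT TA dTP.
have coverE : cover ([set a; x; y] |: P) = [set a; x; y] :|: cover P.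
  rewrite /cover big_setU1 //; apply: contraL dTP => TP.
  apply/pred0Pn; exists x; rewrite /= !inE eqxx orbT /=.
  by apply/bigcupP; exists [set a; x; y]; rewrite // !inE eqxx orbT.
have sS : S :\ a \subset S by apply: subD1set.
have cS : #|S :\ a| = s by move: Ds; rewrite (cardsD1 a) aS => -[].
rewrite addnS -addSn; apply: (IHs _ cS _ _ pP1) => //.
- exact: subset_trans sS SA.
- exact: disjointWl sS dSD.
- rewrite coverE disjoints_subset; apply/subsetP=> z /setD1P[za zS].
  rewrite !inE !negb_or za (disjointFr dSP zS) andbT /=.
  by apply/andP; split; apply: contraFneq (disjointFr dSD zS) => ->.
- by move=> b /setD1P[_ /hK].
suff: #|cover ([set a; x; y] |: P) :&: D| <= 2 + #|cover P :&: D|.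
  by move: leK => /[swap]; rewrite mulnS => ?; apply: leq_trans; rewrite addnA leq_add2r addnC.
have: #|[set x; y]| <= 2 by rewrite cards2; case: (_ != _).
rewrite -(leq_add2r #|cover P :&: D|); apply: leq_trans.
apply: leq_trans (leq_card_setU _ _).1; rewrite coverE.
apply/subset_leq_card/subsetP=> z; rewrite !inE.
case: eqP => [-> | _ /=]; first by rewrite (negPf aD) andbF.
by case/andP=> /orP[->|->] // ->; rewrite orbT.
Qed.

(** * Colour counts and the main induction *)

Lemma bin_succ2 n : 'C(n.+1, 2) = n + 'C(n, 2).
Proof. by rewrite binS bin1 addnC. Qed.

Lemma bin2_double n : 2 * 'C(n, 2) + n = n * n.
Proof. by elim: n => // n IHn; rewrite bin_succ2; lia. Qed.

(** When [m] and [#|A|] both drop by one, the threshold [m * #|A| - 'C(m.+1, 2)] drops by exactly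
    [#|A| - 1], the most colours that deleting one vertex can cost. *)
Lemma colors_setD m A B : m <= #|A| -> B \subset A -> #|B| <= m ->
  m * #|A| < #|colors A| + 'C(m.+1, 2) ->
  (m - #|B|) * (#|A| - #|B|) < #|colors (A :\: B)| + 'C((m - #|B|).+1, 2).
Proof.
move Db: #|B| => b; elim: b m A B Db => [|b IHb] m A B Db mA BA bm.
  by move/eqP: Db; rewrite cards_eq0 => /eqP->; rewrite setD0 !subn0.
have [a aB] : exists a, a \in B by apply/card_gt0P; rewrite Db.
have aA := subsetP BA a aB.
have cB : #|B :\ a| = b by move: Db; rewrite (cardsD1 a) aB => -[].
have cA : #|A| = #|A :\ a|.+1 by rewrite (cardsD1 a) aA.
case: m mA bm => // m mA bm.
rewrite -{2}(setD1K aA) card_colorsU1 cA subSS.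
have ABE : A :\: B = (A :\ a) :\: (B :\ a).
  by apply/setP=> z; rewrite !inE; case: eqP => [->|//]; rewrite aB.
have := card_new_colors a (A :\ a).
rewrite ABE subSS bin_succ2 => ? ?; apply: IHb => //; [lia|by apply: setSD|nia].
Qed.

(** Stated for arbitrary [A] so that the induction can pass to [A :\: B] with [m - #|B|]: the size
    bound then loses [7 * #|B|] on the left and only [#|B|] on the right. *)
Lemma exists_packing m A : 7 * m <= #|A| + 2 ->
  m * #|A| < #|colors A| + 'C(m.+1, 2) -> exists P, packing A m P.
Proof.
elim/ltn_ind: m A => -[|m] IHm A leA hA; first by exists set0; apply: packing0.
have [||| P pP] := IHm m _ A; [by []|lia|by move: hA; rewrite bin_succ2; nia|].
have cT := card_cover_packing _ _ _ pP.
set T := cover P in cT; have TA : T \subset A by case: pP.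
have cAT : #|A :\: T| = #|A| - 3 * m by rewrite cardsD (setIidPr TA) cT.
have [gallai | gallai] := leqP #|A :\: T| #|colors (A :\: T)|.
  have [||U UAT rU] := rainbow_3set_exists (A :\: T); [lia|by []|].
  move: UAT; rewrite subsetD => /andP[UA dUT].
  by exists (U |: P); apply: packingU1.
(* The summand ['C(m.+1 - #|B|, 2)] makes minimality yield ever fewer new colours
   per vertex as [B] grows, matching the [3 * (m.+1 - #|B|) + 2 * #|B|] vertices that
   the construction occupies. *)
pose Q B := (B \subset A) &&
  (#|colors (A :\: B)| + 2 * m.+1 * #|B| + 'C(m.+1, 2)
     < #|colors A| + 'C(m.+1 - #|B|, 2)).
have QT : Q T.
  rewrite /Q TA cT /=; move: hA; rewrite !bin_succ2 => hA.
  have c2 := bin2_double m.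
  (* Source of the constant 7: [2 * m.+1 * #|T|] contributes [6 * m * m], and twice ['C(m.+1, 2)],
     once from [Q] and once from [hA], contributes [m * m]. *)
  have leM : m * (7 * m + 5) <= m * #|A| by rewrite leq_mul2l; lia.
  lia.
have [B /minsetP[/andP[BA QB] minB] _] := minset_exists QT.
have newB a : a \in B -> 2 * m.+1 + (m.+1 - #|B|) <= #|new_colors a (A :\: B)|.
  move=> aB; have cB := cardsD1 a B; rewrite aB in cB.
  have ABE : A :\: (B :\ a) = a |: (A :\: B).
    apply/setP=> z; rewrite !inE; case: eqP => [->|//].
    by rewrite (subsetP BA).
  have: ~~ Q (B :\ a).
    apply/negP=> /minB/(_ (subD1set _ _)) BE.
    by have := setD11 a B; rewrite BE aB.
  rewrite /Q (subset_trans (subD1set _ _) BA) /= ABE card_colorsU1 -leqNgt.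
  move: QB; rewrite cB /= add1n; set k := #|B :\ a|.
  (* For [k] at least [m.+1] both truncated binomials vanish and only the linear term of [Q] counts;
     otherwise they differ by [m.+1 - #|B|]. *)
  have [mk | km] := leqP m.+1 k.
    have [-> ->] : m.+1 - k = 0 /\ m.+1 - k.+1 = 0 by lia.
    lia.
  rewrite -(subnSK km) (bin_succ2 (m.+1 - k.+1)); lia.
have DA : A :\: B \subset A by apply: subsetDl.
have dBD : [disjoint B & A :\: B].
  by rewrite disjoints_subset; apply/subsetP=> z zB; rewrite !inE zB.
(* If [B] is this large, [m.+1] of its vertices serve as apexes, starting from the empty packing. *)
have [mB | Bm] := leqP m.+1 #|B|.
  have /card_geqP[s [us ss sB]] := mB.
  pose S := [set x in s].
  have cS : #|S| = m.+1 by rewrite cardsE -ss; apply/card_uniqP.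
  have SB : S \subset B by apply/subsetP=> z; rewrite inE => /sB.
  rewrite -cS; apply: (@packing_extend A (A :\: B) S 0 (2 * m.+1) set0) => //.
  - exact: packing0.
  - exact: subset_trans SB BA.
  - exact: disjointWl SB dBD.
  - by rewrite /cover big_set0 disjoints_subset setC0 subsetT.
  - by move=> a /(subsetP SB) /newB; lia.
  - by rewrite /cover big_set0 set0I cards0 cS.
(* [Q set0] would compare a number strictly with itself. Nonemptiness makes [m.+1 - #|B|] a
   legitimate smaller case. *)
have B0 : 0 < #|B|.
  rewrite lt0n cards_eq0; apply: contraL QB => /eqP->.
  by rewrite setD0 cards0 muln0 addn0 subn0 ltnn.
have cAB : #|A :\: B| = #|A| - #|B| by rewrite cardsD (setIidPr BA).
have [|||P1 pP1] := IHm (m.+1 - #|B|) _ (A :\: B); [lia|lia| |].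
  by rewrite cAB; apply: colors_setD => //; [lia|apply: ltnW].
have cP1 := card_cover_packing _ _ _ pP1.
have [||P2 pP2] := @packing_extend A _ B _ _ _ (packingS DA pP1) DA BA dBD _ newB.
- rewrite disjoint_sym disjoints_subset; case: pP1 => _ _ PD _.
  by apply: subset_trans PD _; rewrite setDE subsetIr.
- have := subset_leq_card (subsetIl (cover P1) (A :\: B)); rewrite cP1; lia.
by exists P2; rewrite subnK ?(ltnW Bm) in pP2.
Qed.

End Packing.

(* The natural-number subtraction never truncates: 'C(m.+1, 2) <= m * n
   follows from 9 * m + 8 <= n. *)
Theorem theorem1p6 (m n : nat) (V : finType) (G : ecgraph V)
    (hm : 1 <= m) (hV : #|V| = n) (hG : complete G) (hn : 9 * m + 8 <= n)
    (hc : m * n - 'C(m.+1, 2) < ncolors G) :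
  has_proper_mK3 G m.
Proof.
have edgesE : edges G = pairs V setT.
  apply/setP=> e; rewrite [RHS]inE subsetT /=; apply/imset2P/cards2P.
    case=> x y _; rewrite inE => /andP[_ xy] ->; exists x, y; split=> //.
    by apply: contraTneq xy => ->; rewrite (adj_irr G).
  by case=> x [y [xy ->]]; exists x y; rewrite // inE hG.
(* Colours must form a finite type here; with [N] the largest colour, [inord] loses nothing. *)
pose N := \max_(e : {set V}) col G e.
pose c (e : {set V}) : 'I_N.+1 := inord (col G e).
have cE e : c e = col G e :> nat by rewrite inordK // ltnS /N leq_bigmax.
have hc' : ncolors G <= #|colors V _ c setT|.
  rewrite /ncolors cardE -(size_map (@nat_of_ord _)); apply: uniq_leq_size (undup_uniq _) _.
  move=> k; rewrite mem_undup => /imageP[e eE ->]; rewrite -cE.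
  by apply/map_f; rewrite mem_enum imset_f // -edgesE.
have [||P [cP tP _ rP]] := exists_packing V _ c m setT.
- by rewrite cardsT hV; lia.
- by rewrite cardsT hV; lia.
rewrite -cP; exists (fun i => enum_val i); split=> [i | i j ij].
  have [T3 rT] := rP _ (enum_valP i); split; first by split=> // x y _ _ /hG.
  move=> e f; rewrite edgesE !inE !subsetT /= => /andP[e2 eT] /andP[f2 fT] ef.
  by apply: rT; rewrite ?inE ?eT ?fT //; apply: val_inj; rewrite /= !cE.
by apply: (trivIsetP tP); rewrite ?enum_valP // (inj_eq enum_val_inj).
Qed.
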